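(* Let $\Theta\subseteq\mathbb{R}^p$, and for every $\theta\in\Theta$ let $f_{0\theta}\in\mathcal{E}_M$ and let $\Omega_{0\theta}:\mathcal{E}\to\mathcal{E}$ be a linear, self-adjoint, positive semidefinite, trace-class operator with positive square root $\Omega_{0\theta}^{1/2}$. Suppose that for every $\theta\in\Theta$: (R1) $\int_S h(\theta,x)f_{0\theta}(x)\,\Pi(dx)=0$; (R2) $\Omega_{0\theta}^{1/2}h_i(\theta,\cdot)=0$ for each $i=1,\ldots,d$, and $\Omega_{0\theta}^{1/2}1=0$, where $1$ denotes the constant function. For $\theta\in\Theta$ let $\mu(f|\theta)=\mathcal{GP}(f_{0\theta},\Omega_{0\theta})$ be the Gaussian measure on the Borel $\sigma$-field of $\mathcal{E}$ with mean function $f_{0\theta}$ and covariance operator $\Omega_{0\theta}$. Then, for every $\theta\in\Theta$, the trajectories $f$ generated by $\mu(f|\theta)$ satisfy, $\mu(f|\theta)$-almost surely, $$\int_S f(x)\,\Pi(dx)=1\qquad\text{and}\qquad \int_S h(\theta,x)f(x)\,\Pi(dx)=0.$$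
   Context: $S\subseteq\mathbb{R}^m$ is endowed with the trace $\mathfrak{B}_S$ of the Borel $\sigma$-field, and $\Pi$ is a positive measure on $(S,\mathfrak{B}_S)$. $\mathcal{E}:=L^2(S,\mathfrak{B}_S,\Pi)$ is the Hilbert space of (real) square-integrable functions with its usual inner product $\langle\cdot,\cdot\rangle$. The constant function $1$ belongs to $\mathcal{E}$. $M$ is the set of probability density functions on $S$ with respect to $\Pi$, and $\mathcal{E}_M:=\mathcal{E}\cap M$. The function $h=(h_1,\ldots,h_d)^T:\Theta\times\mathbb{R}^m\to\mathbb{R}^d$ is known, with $h_i(\theta,\cdot)\in\mathcal{E}$ for every $i=1,\ldots,d$ and every $\theta\in\Theta$, and $d\ge p$. A Gaussian measure $\mathcal{GP}(m,\Omega)$ on $\mathcal{E}$ is the Borel probability measure such that, for $f\sim\mathcal{GP}(m,\Omega)$ and every $\phi\in\mathcal{E}$, the real random variable $\langle f,\phi\rangle$ is normal (possibly degenerate) with mean $\langle m,\phi\rangle$ and variance $\langle\Omega\phi,\phi\rangle$. *)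

(* Defs.v *)
From HB Require Import structures.
From mathcomp Require Import all_boot all_order all_algebra.
From mathcomp Require Import all_classical all_reals all_analysis.
From mathcomp Require Import measurable_realfun.

Set Implicit Arguments.
Unset Strict Implicit.
Unset Printing Implicit Defensive.
Import Order.TTheory GRing.Theory Num.Theory.
Import numFieldNormedType.Exports.

Local Open Scope classical_set_scope.
Local Open Scope ring_scope.

Definition borel (T : ptopologicalType) := g_sigma_algebraType (@open T).

HB.instance Definition _ (T : ptopologicalType) := Measurable.on (borel T).

(* A [measurableType] is inhabited, hence the nonemptiness proof [S0].  The
   sigma-algebra of [trace_space S0] is {S `&` B | B Borel}, read on the
   subtype [S]. *)
Section trace_space.
Context {T : ptopologicalType} (S : set T) (S0 : S !=set0).

Definition nonempty_subtype : Type := S.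

HB.instance Definition _ := Choice.on nonempty_subtype.
HB.instance Definition _ := isPointed.Build nonempty_subtype
  (SigSub (mem_set (svalP (cid S0)))).

Definition trace_val (x : nonempty_subtype) : T := set_val (x : S).

Definition trace_space :=
  g_sigma_algebra_preimageType (trace_val : nonempty_subtype -> borel T).

HB.instance Definition _ := Measurable.on trace_space.

End trace_space.

Section L2.
Context d (T : measurableType d) (R : realType).
Variable mu : {measure set T -> \bar R}.

(* The library's L^2 (classes of a.e. equal functions) comes without algebraic
   structure; it is made a [normedModType] below. *)
Definition L2 : Type := LspaceType2 mu.

Definition L2_fun (u : L2) : T -> R := (u : LspaceType2 mu).

End L2.
Coercion L2_fun : L2 >-> Funclass.

Section L2_theory.
Context d (T : measurableType d) (R : realType).
Variable mu : {measure set T -> \bar R}.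
Local Notation mfunR := {mfun T >-> measurableTypeR R}.
Local Notation quotR := {mfun_ mu, T >-> measurableTypeR R}.
Local Notation Lfun2 := (@Lfun _ T R mu 2%:E).
Local Notation E := (L2 mu).
Implicit Types (u v w : E) (f g : T -> R) (a : R).

Lemma ae_eq_Lnorm2 f g : f \in @mfun _ _ T R -> g \in @mfun _ _ T R ->
  f = g %[ae mu] ->
  ('N[mu]_2%:E[EFin \o f] = 'N[mu]_2%:E[EFin \o g])%E.
Proof.
rewrite !inE /= => mf mg fg; rewrite unlock; congr poweR.
have m (k : T -> R) : measurable_fun [set: T] k ->
    measurable_fun [set: T] (fun x => (`|k x| `^ 2)%R).
  move=> mk; apply: (@measurableT_comp _ _ _ _ _ _ (fun x : R => x `^ 2)) => //.
  exact: measurableT_comp.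
apply: ge0_ae_eq_integral => //.
- exact/measurable_EFinP/m.
- exact/measurable_EFinP/m.
- by move=> x _; rewrite lee_fin powR_ge0.
- by move=> x _; rewrite lee_fin powR_ge0.
by apply: filterS fg => x /= /[apply] ->.
Qed.

Lemma L2_mfun u : (u : T -> R) \in @mfun _ _ T R.
Proof. by rewrite inE /=; exact: (measurable_funPT (repr (u : quotR))). Qed.

Lemma L2_Lfun u : (u : T -> R) \in Lfun2.
Proof.
apply/andP; split; first exact: L2_mfun.
by rewrite inE /=; exact: Lebesgue_finite.
Qed.

Section L2_class.
Variables (f : T -> R) (f2 : f \in Lfun2).

Let f_mfun : mfunR :=
  @mfun_Sub _ _ T (measurableTypeR R) f (sub_Lfun_mfun f2).

Let f_quot : quotR := \pi_quotR%qT f_mfun.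

Let f_quotE : (f_quot : T -> R) = f %[ae mu].
Proof.
by have /eqP := reprK f_quot; rewrite eqmodE => /asboolP.
Qed.

Let f_quot_finite : finite_norm mu 2%:E f_quot.
Proof.
have /andP[mf] := f2; rewrite inE /= /finite_norm => nf.
rewrite (ae_eq_Lnorm2 _ mf f_quotE)// inE.
exact: (measurable_funPT (repr f_quot)).
Qed.

Definition L2_class : E :=
  HB.pack_for (LspaceType2 mu) f_quot
    (@isFinLebesgue.Build _ _ _ _ _ (lee1n 2) f_quot f_quot_finite).

Lemma L2_classE : (L2_class : T -> R) = f %[ae mu].
Proof. exact: f_quotE. Qed.

End L2_class.

Lemma L2_eqP u v : (u : T -> R) = v %[ae mu] <-> u = v.
Proof.
split=> [uv|->]; last by apply: nearW.
have : (u : quotR) = v.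
  rewrite -[LHS]reprK -[RHS]reprK; apply/eqP; rewrite eqmodE.
  exact/asboolP.
case: u v {uv} => [u [[u2]]] [v [[v2]]] /= uv.
by case: _ / uv v2 => v2; rewrite (bool_irrelevance u2 v2).
Qed.

Lemma Lfun2D f g : f \in Lfun2 -> g \in Lfun2 -> f \+ g \in Lfun2.
Proof. exact: (Lfun_addr_closed mu (lee1n 2)).2. Qed.

Lemma Lfun2Z a f : f \in Lfun2 -> a \*: f \in Lfun2.
Proof.
move=> f2; have := (Lfun_submod_closed mu (lee1n 2)).2 a f (cst 0) f2.
have -> : a *: f + cst 0 = a \*: f by apply/funext => x; rewrite !fctE addr0.
by apply; exact: (Lfun_addr_closed mu (lee1n 2)).1.
Qed.

Lemma Lfun20 : cst 0 \in Lfun2.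
Proof. exact: (Lfun_addr_closed mu (lee1n 2)).1. Qed.

Definition L2_zero : E := L2_class Lfun20.
Definition L2_add u v : E := L2_class (Lfun2D (L2_Lfun u) (L2_Lfun v)).
Definition L2_scale a u : E := L2_class (Lfun2Z a (L2_Lfun u)).
Definition L2_opp u : E := L2_scale (-1) u.

Let zeroE : (L2_zero : T -> R) = cst 0 %[ae mu].
Proof. exact: L2_classE. Qed.
Let addE u v : (L2_add u v : T -> R) = (u : T -> R) \+ v %[ae mu].
Proof. exact: L2_classE. Qed.
Let scaleE a u : (L2_scale a u : T -> R) = a \*: (u : T -> R) %[ae mu].
Proof. exact: L2_classE. Qed.

Let addA : associative L2_add.
Proof.
move=> u v w; apply/L2_eqP.
apply: filter_app (addE u (L2_add v w)); apply: filter_app (addE v w).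
apply: filter_app (addE (L2_add u v) w); apply: filter_app (addE u v).
by apply: aeW => x /(_ I) e1 /(_ I) e2 /(_ I) e3 /(_ I) e4 _;
  rewrite e4 /= e3 e2 /= e1 /= addrA.
Qed.

Let addC : commutative L2_add.
Proof.
move=> u v; apply/L2_eqP.
apply: filter_app (addE u v); apply: filter_app (addE v u).
by apply: aeW => x /(_ I) e1 /(_ I) e2 _; rewrite e1 e2 /= addrC.
Qed.

Let add0 : left_id L2_zero L2_add.
Proof.
move=> u; apply/L2_eqP.
apply: filter_app (addE L2_zero u); apply: filter_app zeroE.
by apply: aeW => x /(_ I) e1 /(_ I) e2 _; rewrite e2 /= e1 add0r.
Qed.

Let addN : left_inverse L2_zero L2_opp L2_add.
Proof.
move=> u; apply/L2_eqP.
apply: filter_app (addE (L2_opp u) u); apply: filter_app zeroE.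
apply: filter_app (scaleE (-1) u).
apply: aeW => x /(_ I) e1 /(_ I) e2 /(_ I) e3 _.
by rewrite e3 e2 /= e1 /= scaleN1r addNr.
Qed.

HB.instance Definition _ := gen_eqMixin E.
HB.instance Definition _ := gen_choiceMixin E.
HB.instance Definition _ := GRing.isZmodule.Build E addA addC add0 addN.

Let scaleA a b u : L2_scale a (L2_scale b u) = L2_scale (a * b) u.
Proof.
apply/L2_eqP.
apply: filter_app (scaleE a (L2_scale b u)); apply: filter_app (scaleE b u).
apply: filter_app (scaleE (a * b) u).
apply: aeW => x /(_ I) e1 /(_ I) e2 /(_ I) e3 _.
by rewrite e3 /= e2 e1 /= scalerA.
Qed.

Let scale1 : left_id 1 L2_scale.
Proof.
move=> u; apply/L2_eqP; apply: filter_app (scaleE 1 u).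
by apply: aeW => x /(_ I) e1 _; rewrite e1 /= scale1r.
Qed.

Let scaleDr : right_distributive L2_scale L2_add.
Proof.
move=> a u v; apply/L2_eqP.
apply: filter_app (scaleE a (L2_add u v)); apply: filter_app (addE u v).
apply: filter_app (addE (L2_scale a u) (L2_scale a v)).
apply: filter_app (scaleE a u); apply: filter_app (scaleE a v).
apply: aeW => x /(_ I) e1 /(_ I) e2 /(_ I) e3 /(_ I) e4 /(_ I) e5 _.
by rewrite e5 /= e4 e3 /= e2 e1 /= scalerDr.
Qed.

Let scaleDl u : {morph L2_scale^~ u : a b / a + b >-> L2_add a b}.
Proof.
move=> a b; apply/L2_eqP.
apply: filter_app (scaleE (a + b) u).
apply: filter_app (addE (L2_scale a u) (L2_scale b u)).
apply: filter_app (scaleE a u); apply: filter_app (scaleE b u).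
apply: aeW => x /(_ I) e1 /(_ I) e2 /(_ I) e3 /(_ I) e4 _.
by rewrite e4 e3 /= e2 e1 /= scalerDl.
Qed.

HB.instance Definition _ :=
  GRing.Zmodule_isLmodule.Build R E scaleA scale1 scaleDr scaleDl.

Lemma L2_addE u v : (u + v : T -> R) = (u : T -> R) \+ v %[ae mu].
Proof. exact: addE. Qed.

Lemma L2_scaleE a u : (a *: u : T -> R) = a \*: (u : T -> R) %[ae mu].
Proof. exact: scaleE. Qed.

Definition L2_norm u : R := fine ('N[mu]_2%:E[EFin \o u])%E.

Let normE u : (L2_norm u)%:E = ('N[mu]_2%:E[EFin \o u])%E.
Proof. exact: (finite_norm_fine (Lfun_Sub (lee1n 2) (L2_Lfun u))). Qed.

Let norm_class f (f2 : f \in Lfun2) :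
  (L2_norm (L2_class f2))%:E = ('N[mu]_2%:E[EFin \o f])%E.
Proof.
rewrite normE; apply: ae_eq_Lnorm2; [exact: L2_mfun|exact: sub_Lfun_mfun f2|].
exact: L2_classE.
Qed.

Let normD u v : L2_norm (u + v) <= L2_norm u + L2_norm v.
Proof.
rewrite -lee_fin EFinD norm_class !normE; apply: eminkowski.
- by have := L2_mfun u; rewrite inE.
- by have := L2_mfun v; rewrite inE.
- exact: lee1n.
Qed.

Let normZ a u : L2_norm (a *: u) = `|a| * L2_norm u.
Proof.
apply: EFin_inj; rewrite EFinM norm_class normE.
exact: (LnormZ (Lfun_Sub (lee1n 2) (L2_Lfun u))).
Qed.

Let norm0_eq0 u : L2_norm u = 0 -> u = 0.
Proof.
move=> u0; apply/L2_eqP.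
have := fine_Lnormr_eq0 (f := Lfun_Sub (lee1n 2) (L2_Lfun u)) u0.
apply: filter_app; apply: filter_app zeroE.
by apply: aeW => x /(_ I) e1 /(_ I) e2 _; exact: (etrans e2 (esym e1)).
Qed.

HB.instance Definition _ := Lmodule_isNormed.Build R E normD normZ norm0_eq0.

End L2_theory.

Section hilbert.
Context d (T : measurableType d) (R : realType).
Variable mu : {measure set T -> \bar R}.
Local Notation E := (L2 mu).
Implicit Types (u v : E) (A B : {linear E -> E}).

Definition L2_inner u v : R := (\int[mu]_x (u x * v x))%R.

Lemma L2_inner_norm u : L2_inner u u = `|u| ^+ 2.
Proof.
have fN : (`|u|%:E = 'N[mu]_2%:E[EFin \o u])%E.
  exact: (finite_norm_fine (Lfun_Sub (lee1n 2) (L2_Lfun u))).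
have := @poweR_Lnorm _ _ _ mu (EFin \o u) 2 (lt0r_neq0 (@ltr0Sn R 1)).
rewrite -fN poweR_EFin powR_mulrn// => nE.
rewrite /L2_inner /Rintegral; apply: EFin_inj; rewrite nE.
suff -> : (\int[mu]_x (u x * u x)%:E = \int[mu]_x `|(EFin \o u) x| `^ 2)%E.
  by rewrite -nE.
apply: eq_integral => x _ /=.
by rewrite powR_mulrn// real_normK ?num_real// expr2.
Qed.

Definition density : set (T -> R) :=
  [set g : T -> R | [/\ measurable_fun [set: T] g, (forall x, 0 <= g x) &
               (\int[mu]_x (g x)%:E = 1)%E]].

Definition L2_density : set E :=
  [set u : E | exists2 g, density g & (u : T -> R) = g %[ae mu]].

Definition self_adjoint A := forall u v, L2_inner (A u) v = L2_inner u (A v).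

Definition positive_semidef A := forall u, 0 <= L2_inner (A u) u.

Definition positive_sqrt B A :=
  [/\ self_adjoint B, positive_semidef B & forall u, B (B u) = A u].

Definition orthonormal_basis (e : set E) :=
  [/\ forall u, e u -> L2_inner u u = 1,
      forall u v, e u -> e v -> u <> v -> L2_inner u v = 0 &
      forall u, (forall v, e v -> L2_inner u v = 0) -> u = 0].

(* [B] is |A|, the positive square root of A* A; A* is avoided by writing
   <A* A u, v> as <A u, A v>. *)
Definition modulus B A :=
  [/\ self_adjoint B, positive_semidef B &
      forall u v, L2_inner (B (B u)) v = L2_inner (A u) (A v)].

(* [E] need not be separable, hence the sum over a possibly uncountable
   orthonormal basis. *)
Definition trace_class A :=
  continuous A /\
  exists B : {linear E -> E}, modulus B A /\
  exists2 e : set E, orthonormal_basis e &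
    (\esum_(u in e) (L2_inner (B u) u)%:E < +oo)%E.

(* [normal_prob m s] is parametrized by the standard deviation and is not the
   Dirac mass at [m] when [s = 0]. *)
Definition normal_law (m v : R) : set (measurableTypeR R) -> \bar R :=
  if v == 0 then dirac m else normal_prob m (Num.sqrt v).

Definition gaussian_measure (P : probability (borel E) R) (m : E)
    (Om : {linear E -> E}) :=
  forall phi : E, forall A : set (measurableTypeR R), measurable A ->
    pushforward P (fun f : borel E => L2_inner f phi : measurableTypeR R) A =
    normal_law (L2_inner m phi) (L2_inner (Om phi) phi) A.

End hilbert.

(* Main.v *)
(* For phi in the kernel of Omega^(1/2), the law of <f, phi> has variance
   <Omega phi, phi> = 0, so <f, phi> = <f0, phi> almost surely. This applies to
   phi = 1 and phi = h_i, where <f0, 1> = 1 and <f0, h_i> = 0. *)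
Require Import Defs.
From mathcomp Require Import all_boot all_order all_algebra.
From mathcomp Require Import all_classical all_reals all_analysis.
From mathcomp Require Import measurable_realfun.

Set Implicit Arguments.
Unset Strict Implicit.
Unset Printing Implicit Defensive.
Import Order.TTheory GRing.Theory Num.Theory.
Import numFieldNormedType.Exports.

Local Open Scope classical_set_scope.
Local Open Scope ring_scope.

Section L2_inner_theory.
Context d (T : measurableType d) (R : realType).
Variable mu : {measure set T -> \bar R}.
Local Notation E := (L2 mu).
Implicit Types (u v w : E) (f g : T -> R).

Lemma integrable_L2_mul u v :
  mu.-integrable [set: T] (EFin \o (fun x => u x * v x)).
Proof. by apply/Lfun1_integrable/Lfun2_mul_Lfun1; exact: L2_Lfun. Qed.

Lemma measurable_L2 u : measurable_fun [set: T] (u : T -> R).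
Proof. by have := L2_mfun u; rewrite inE. Qed.

(** Bridge between extended-real integrals and the real inner product: a product of two
    square-integrable functions is integrable, so the [fine] hidden in [Rintegral] loses nothing.
    Arbitrary measurable representatives are allowed because operations on classes are known only up
    to null sets. *)
Lemma ae_eq_L2_inner u v f g :
  measurable_fun [set: T] f -> measurable_fun [set: T] g ->
  (u : T -> R) = f %[ae mu] -> (v : T -> R) = g %[ae mu] ->
  (\int[mu]_x (f x * g x)%:E = (L2_inner u v)%:E)%E.
Proof.
move=> mf mg uf vg; rewrite /L2_inner /Rintegral fineK; last first.
  exact/integrable_fin_num/integrable_L2_mul.
apply: ae_eq_integral => //.
- exact/measurable_EFinP/measurable_funM.
- by apply/measurable_EFinP/measurable_funM; exact: measurable_L2.
by apply: filterS2 uf vg => x uf vg Dx; rewrite uf// vg.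
Qed.

Lemma L2_innerDl u v w : L2_inner (u + v) w = L2_inner u w + L2_inner v w.
Proof.
have mL2 := measurable_L2.
(* The class [u + v] agrees with the pointwise sum only almost everywhere, so the representative is
   changed before additivity of the integral applies. *)
apply: EFin_inj; rewrite EFinD -(@ae_eq_L2_inner _ _ ((u : T -> R) \+ v) w).
- rewrite -(@ae_eq_L2_inner u w u w) -?(@ae_eq_L2_inner v w v w)//;
    try exact: nearW.
  rewrite -integralD_EFin//; [|exact: integrable_L2_mul..].
  by apply: eq_integral => x _ /=; rewrite mulrDl.
- exact: measurable_funD.
- exact: mL2.
- exact: L2_addE.
- exact: nearW.
Qed.

Lemma L2_innerBl u v w : L2_inner (u - v) w = L2_inner u w - L2_inner v w.
Proof. by apply/eqP; rewrite eq_sym subr_eq -L2_innerDl subrK. Qed.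

Lemma L2_inner0l w : L2_inner 0 w = 0.
Proof. by rewrite -(subrr w) L2_innerBl subrr. Qed.

(** Hölder's inequality with both exponents equal to 2, once the absolute value is moved inside the
    integral. *)
Lemma L2_inner_cauchy_schwarz u v : `|L2_inner u v| <= `|u| * `|v|.
Proof.
have normE w : (`|w|%:E = 'N[mu]_2%:E[EFin \o w])%E.
  exact: (finite_norm_fine (Lfun_Sub (lee1n 2) (L2_Lfun w))).
rewrite -lee_fin EFinM !normE.
have iuv := integrable_L2_mul u v.
rewrite -abse_EFin -(@ae_eq_L2_inner _ _ u v); [|exact: measurable_L2..|
  exact: nearW|exact: nearW].
apply: (le_trans (le_abse_integral mu measurableT (measurable_int _ iuv))).
rewrite -[leLHS](Lnorm1 mu); apply: hoelder => //; try exact: measurable_L2.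
by rewrite [RHS]splitr !div1r.
Qed.

Lemma continuous_L2_inner v : continuous (fun u : E => L2_inner u v : R).
Proof.
move=> u; apply/(@cvgrPdist_le _ _ _ (nbhs u)) => e e0; near=> w.
rewrite -L2_innerBl (le_trans (L2_inner_cauchy_schwarz _ _))//.
(* The added 1 keeps the divisor of [e] positive even when [v] is zero. *)
rewrite (@le_trans _ _ (`|u - w| * (`|v| + 1)))//.
  by rewrite ler_wpM2l// lerDl.
rewrite -ler_pdivlMr ?ltr_wpDl//; near: w.
apply: (@cvgr_dist_le _ _ _ (nbhs u) _ id u); [exact: cvg_id|].
by rewrite divr_gt0// ltr_wpDl.
Unshelve. all: by end_near. Qed.

(* [borel E] is generated by the norm topology, so that the exceptional set of
   the almost sure statement is measurable by continuity of the inner product. *)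
Lemma measurable_L2_inner_neq v (c : R) :
  measurable ([set u | L2_inner u v <> c] : set (borel E)).
Proof.
apply: sub_sigma_algebra.
rewrite -[X in open X]/((fun u : E => L2_inner u v) @^-1` ~` [set c]).
apply: open_comp; first by move=> u _; exact: continuous_L2_inner.
exact/closed_openC/closed_eq.
Qed.

Lemma gaussian_measure_ker (P : probability (borel E) R) (m phi : E)
    (Om : {linear E -> E}) :
  gaussian_measure P m Om -> L2_inner (Om phi) phi = 0 ->
  {ae P, forall f : E, L2_inner f phi = L2_inner m phi}.
Proof.
move=> gP Om0; exists [set f | L2_inner f phi <> L2_inner m phi]; split => //.
  exact: measurable_L2_inner_neq.
(* The law is tested on the complement of its mean, which the Dirac mass of the degenerate case does
   not charge. *)
have := gP phi (~` [set L2_inner m phi]) (measurableC (measurable_set1 _)).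
rewrite /pushforward /normal_law Om0 eqxx => ->.
by rewrite diracE memNset// => /(_ erefl).
Qed.

End L2_inner_theory.

Theorem lemma2p1 (R : realType) (m p d : nat) (le_pd : (p <= d)%N)
  (S : set 'rV[R]_m) (S0 : S !=set0)
  (Pi : {measure set (trace_space S0) -> \bar R})
  (one_L2 : (fun=> 1) \in @Lfun _ (trace_space S0) R Pi 2%:E)
  (Theta : set 'rV[R]_p)
  (h : Theta -> 'rV[R]_m -> 'cV[R]_d)
  (h_L2 : forall (theta : Theta) (i : 'I_d),
    (fun x : trace_space S0 => h theta (trace_val x) i 0) \in @Lfun _ (trace_space S0) R Pi 2%:E)
  (f0 : Theta -> L2 Pi)
  (f0_density : forall theta, L2_density (f0 theta))
  (Omega sqrtOmega : Theta -> {linear L2 Pi -> L2 Pi})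
  (Omega_sa : forall theta, self_adjoint (Omega theta))
  (Omega_psd : forall theta, positive_semidef (Omega theta))
  (Omega_tc : forall theta, trace_class (Omega theta))
  (sqrtOmegaP : forall theta, positive_sqrt (sqrtOmega theta) (Omega theta))
  (R1 : forall theta i,
    (\int[Pi]_x (h theta (trace_val x) i 0 * f0 theta x)%:E = 0)%E)
  (R2_h : forall theta i, sqrtOmega theta (L2_class (h_L2 theta i)) = 0)
  (R2_one : forall theta, sqrtOmega theta (L2_class one_L2) = 0)
  (mu : Theta -> probability (borel (L2 Pi)) R)
  (mu_gaussian : forall theta,
    gaussian_measure (mu theta) (f0 theta) (Omega theta)) :
  forall theta : Theta,
    {ae mu theta, forall f : L2 Pi,
      (\int[Pi]_x (f x)%:E = 1)%E /\
      forall i, (\int[Pi]_x (h theta (trace_val x) i 0 * f x)%:E = 0)%E}.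
Proof.
move=> theta; have [_ _ BB] := sqrtOmegaP theta.
have inner_ae (phi : L2 Pi) : sqrtOmega theta phi = 0 ->
    {ae mu theta, forall f : L2 Pi, L2_inner f phi = L2_inner (f0 theta) phi}.
  move=> B0; apply: gaussian_measure_ker (mu_gaussian theta) _.
  (* The variance vanishes by applying the square root twice: already its first application sends
     [phi] to 0. *)
  by rewrite -BB B0 linear0 L2_inner0l.
have mL2 g : g \in @Lfun _ (trace_space S0) R Pi 2%:E ->
    measurable_fun [set: trace_space S0] g.
  by move=> /sub_Lfun_mfun; rewrite inE.
(* Both constraints become inner products with fixed elements of the space, for every [f], so each
   identity serves the trajectory and the mean alike. *)
have int1 (f : L2 Pi) :
    (\int[Pi]_x (f x)%:E = (L2_inner f (L2_class one_L2))%:E)%E.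
  rewrite -(@ae_eq_L2_inner _ _ _ _ _ _ f (fun=> 1)).
  - by apply: eq_integral => x _; rewrite mulr1.
  - exact: measurable_L2.
  - exact: mL2.
  - exact: nearW.
  - exact: L2_classE.
have inth (f : L2 Pi) i : (\int[Pi]_x (h theta (trace_val x) i 0 * f x)%:E =
    (L2_inner f (L2_class (h_L2 theta i)))%:E)%E.
  rewrite -(@ae_eq_L2_inner _ _ _ _ _ _ f
    (fun x => h theta (trace_val x) i 0)).
  - by apply: eq_integral => x _; rewrite mulrC.
  - exact: measurable_L2.
  - exact: mL2.
  - exact: nearW.
  - exact: L2_classE.
(* The mean is only a class; its total mass is that of a genuine density [g] representing it. *)
have int_f0 : (\int[Pi]_x (f0 theta x)%:E = 1)%E.
  have [g [mg g0 <-] f0g] := f0_density theta.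
  apply: ae_eq_integral => //; first exact/measurable_EFinP/measurable_L2.
    exact/measurable_EFinP.
  by apply: filterS f0g => x /[apply] ->.
have ae1 := inner_ae _ (R2_one theta).
have aeh : {ae mu theta, forall f : L2 Pi, forall i,
    L2_inner f (L2_class (h_L2 theta i)) =
    L2_inner (f0 theta) (L2_class (h_L2 theta i))}.
  (* The index [i] ranges over a finite type, so the [d] almost sure events hold simultaneously. *)
  by apply: filter_forall => i; exact: inner_ae (R2_h theta i).
apply: (@filterS2 _ _ (ae_filter_ringOfSetsType (mu theta)) _ _ _ _ ae1 aeh).
move=> f f1 fh; split=> [|i].
  (* [int1] is read forwards for [f] and backwards for the mean. *)
  by rewrite int1 f1 -int1 int_f0.
by rewrite inth fh -inth R1.
Qed.
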